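(* For any $n\ge3$ and odd $k\ge3$, $$\mathrm{rank}_{\mathbf Z}(H_1(\mathfrak b_n,\mathbf Z)_k)\ \ge\ \binom{n+k-1}{k}-\frac{n(n+1)}{2}.$$ In particular, $H_1(\mathfrak b_n,\mathbf Z)$ is not finitely generated as a $\mathbf Z$-module.
   Context: Let $\mathcal L_n=\bigoplus_{k\ge1}\mathcal L_n(k)$ be the free Lie algebra over $\mathbf Z$ on the free abelian group $H$ with basis $x_1,\dots,x_n$, graded by weight, and let $x_1^*,\dots,x_n^*$ be the dual basis of $H^*$. Brackets $[a_1,\dots,a_k]$ are left-normed. An element of $H^*\otimes_{\mathbf Z}\mathcal L_n(k+1)=\mathrm{Hom}_{\mathbf Z}(H,\mathcal L_n(k+1))$ is identified with the derivation of $\mathcal L_n$ of degree $k$ extending it; the bracket of derivations is $[f,g]=g\circ f-f\circ g$. For $k\ge1$, $\mathfrak p_n(k)$ is the $\mathbf Z$-submodule of $H^*\otimes\mathcal L_n(k+1)$ generated by all $x_i^*\otimes[x_{j_1},\dots,x_{j_k},x_i]$ with $1\le i,j_1,\dots,j_k\le n$, and $\mathfrak b_n(k)=\{\sum_i x_i^*\otimes C_i\in\mathfrak p_n(k)\mid\sum_iC_i=0\}$. The graded sum $\mathfrak b_n=\bigoplus_{k\ge1}\mathfrak b_n(k)$ is a Lie subalgebra of the derivation Lie algebra. $H_1(\mathfrak b_n,\mathbf Z)=\mathfrak b_n/[\mathfrak b_n,\mathfrak b_n]$ is its abelianization, graded by degree, and $H_1(\mathfrak b_n,\mathbf Z)_k$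 is its degree $k$ part. *)

(* Defs.v *)
From HB Require Import structures.
From mathcomp Require Import all_boot all_order all_algebra.
From mathcomp Require Import boolp classical_sets.

Set Implicit Arguments.
Unset Strict Implicit.
Unset Printing Implicit Defensive.

Import GRing.Theory.
Local Open Scope ring_scope.
Local Open Scope quotient_scope.

Inductive zspan_prop (V : zmodType) (S : set V) : V -> Prop :=
| ZspanGen v : S v -> zspan_prop S v
| Zspan0 : zspan_prop S 0
| ZspanB u v : zspan_prop S u -> zspan_prop S v -> zspan_prop S (u - v).

Definition zspan (V : zmodType) (S : set V) : {pred V} :=
  [pred v | `[< zspan_prop S v >]].

Section ZspanTheory.
Variables (V : zmodType) (S : set V).

Lemma zspanP v : reflect (zspan_prop S v) (v \in zspan S).
Proof. exact: asboolP. Qed.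

Fact zspan_zmod_closed : zmod_closed (zspan S).
Proof.
split=> [|u v /zspanP Su /zspanP Sv]; apply/zspanP; first exact: Zspan0.
exact: ZspanB.
Qed.
HB.instance Definition _ := GRing.isZmodClosed.Build V (zspan S) zspan_zmod_closed.

Lemma zspan_gen v : S v -> v \in zspan S.
Proof. by move=> Sv; apply/zspanP/ZspanGen. Qed.

Lemma zspan_ind (P : V -> Prop) :
    (forall v, S v -> P v) -> P 0 -> (forall u v, P u -> P v -> P (u - v)) ->
  forall v, v \in zspan S -> P v.
Proof. by move=> Pg P0 PB v /zspanP; elim=> *; auto. Qed.

End ZspanTheory.

Definition zfingen (V : zmodType) : Prop :=
  exists s : seq V, forall v : V, v \in zspan [set` s].

Definition zindep (V : zmodType) (m : nat) (v : 'I_m -> V) : Prop :=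
  forall c : 'I_m -> int, \sum_(i < m) v i *~ c i = 0 -> forall i, c i = 0.

Definition is_zrank (V : zmodType) (A : {pred V}) (r : nat) : Prop :=
  (exists v : 'I_r -> V, (forall i, v i \in A) /\ zindep v) /\
  (forall m (v : 'I_m -> V), (forall i, v i \in A) -> zindep v -> (m <= r)%N).

(* The value is 0 when A has infinite rank. *)
Definition zrank (V : zmodType) (A : {pred V}) : nat :=
  xget 0%N [set r | is_zrank A r].

Lemma is_zrank_uniq (V : zmodType) (A : {pred V}) r s :
  is_zrank A r -> is_zrank A s -> r = s.
Proof.
move=> [[v [vA vi]] rmax] [[w [wA wi]] smax].
by apply/eqP; rewrite eqn_leq (rmax _ _ wA wi) (smax _ _ vA vi).
Qed.

Lemma zrankE (V : zmodType) (A : {pred V}) r : is_zrank A r -> zrank A = r.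
Proof. by move=> Ar; apply: xget_unique => // s /is_zrank_uniq; apply. Qed.

(* Z-bilinearity is biadditivity, so these are the Lie algebras over Z. *)
HB.mixin Record isLieRing V of GRing.Zmodule V := {
  lie : V -> V -> V;
  lieDl : forall a b c, lie (a + b) c = lie a c + lie b c;
  lieDr : forall a b c, lie a (b + c) = lie a b + lie a c;
  liexx : forall a, lie a a = 0;
  lieJ : forall a b c,
    lie a (lie b c) + lie b (lie c a) + lie c (lie a b) = 0
}.
#[short(type="lieRingType")]
HB.structure Definition LieRing := {V of GRing.Zmodule V & isLieRing V}.

Section LieTheory.
Variable g : lieRingType.
Implicit Types a b c : g.

Lemma lie0r a : lie 0 a = 0.
Proof. by apply: (addrI (lie 0 a)); rewrite -lieDl !addr0. Qed.

Lemma lier0 a : lie a 0 = 0.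
Proof. by apply: (addrI (lie a 0)); rewrite -lieDr !addr0. Qed.

Lemma lieNl a b : lie (- a) b = - lie a b.
Proof. by apply: (addrI (lie a b)); rewrite -lieDl !subrr lie0r. Qed.

Lemma lieNr a b : lie a (- b) = - lie a b.
Proof. by apply: (addrI (lie a b)); rewrite -lieDr !subrr lier0. Qed.

Lemma lieBl a b c : lie (a - b) c = lie a c - lie b c.
Proof. by rewrite lieDl lieNl. Qed.

Lemma lieBr a b c : lie a (b - c) = lie a b - lie a c.
Proof. by rewrite lieDr lieNr. Qed.

Lemma lieC a b : lie a b = - lie b a.
Proof.
apply/eqP; rewrite -addr_eq0; apply/eqP.
by have := liexx (a + b); rewrite lieDl !lieDr !liexx addr0 add0r.
Qed.

Lemma lie_assoc a b c : lie a (lie b c) = lie (lie a b) c - lie (lie a c) b.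
Proof.
have := lieJ a b c; rewrite -addrA => /eqP; rewrite addr_eq0 => /eqP ->.
rewrite opprD addrC; congr (_ + _); first by rewrite [RHS]lieC.
by rewrite (lieC b) (lieC c a) lieNl !opprK.
Qed.

(* [a_1, ..., a_k] = [[...[a_1, a_2], ...], a_k] *)
Definition lnormed (s : seq g) : g :=
  if s is a :: s' then foldl lie a s' else 0.

Lemma lnormed_rcons s a : s != [::] -> lnormed (rcons s a) = lie (lnormed s) a.
Proof. by case: s => //= b s _; rewrite -cats1 foldl_cat. Qed.

Definition lie_derived : {pred g} :=
  zspan [set c : g | exists a b, c = lie a b].
HB.instance Definition _ := GRing.ZmodClosed.on lie_derived.

(* H_1(g, Z) = g / [g, g] *)
Definition lieH1 := Quotient.quot lie_derived.
HB.instance Definition _ := GRing.Zmodule.on lieH1.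

Definition lie_ab (a : g) : lieH1 := \pi_(Quotient.quot lie_derived) a.

Fact lie_ab_zmod_morphism : zmod_morphism lie_ab.
Proof. by move=> a b; rewrite /lie_ab raddfB. Qed.
HB.instance Definition _ :=
  GRing.isZmodMorphism.Build g lieH1 lie_ab lie_ab_zmod_morphism.

Lemma lie_ab_eq0 a : (lie_ab a == 0) = (a \in lie_derived).
Proof.
have := Quotient.idealrBE lie_derived a 0; rewrite subr0 => ->.
by rewrite [in RHS](raddf0 (\pi_(Quotient.quot lie_derived))).
Qed.

Lemma lie_ab_surj (h : lieH1) : exists a, h = lie_ab a.
Proof. by exists (repr (h : Quotient.quot lie_derived)); rewrite /lie_ab reprK. Qed.

End LieTheory.

(* The free Lie algebra over Z on x_0, ..., x_(n-1): Lie terms modulo the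
   congruence generated by the axioms of Lie algebras. *)
Inductive lie_term (n : nat) : Type :=
| TVar of 'I_n
| T0
| TAdd of lie_term n & lie_term n
| TOpp of lie_term n
| TLie of lie_term n & lie_term n.
Arguments T0 {n}.

HB.instance Definition _ n := gen_eqMixin (lie_term n).
HB.instance Definition _ n := gen_choiceMixin (lie_term n).

Inductive lie_congr (n : nat) : lie_term n -> lie_term n -> Prop :=
| LC_refl a : lie_congr a a
| LC_sym a b : lie_congr a b -> lie_congr b a
| LC_trans a b c : lie_congr a b -> lie_congr b c -> lie_congr a c
| LC_add a a' b b' :
    lie_congr a a' -> lie_congr b b' -> lie_congr (TAdd a b) (TAdd a' b')
| LC_opp a a' : lie_congr a a' -> lie_congr (TOpp a) (TOpp a')
| LC_lie a a' b b' :
    lie_congr a a' -> lie_congr b b' -> lie_congr (TLie a b) (TLie a' b')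
| LC_addA a b c : lie_congr (TAdd a (TAdd b c)) (TAdd (TAdd a b) c)
| LC_addC a b : lie_congr (TAdd a b) (TAdd b a)
| LC_add0 a : lie_congr (TAdd T0 a) a
| LC_addN a : lie_congr (TAdd (TOpp a) a) T0
| LC_lieDl a b c :
    lie_congr (TLie (TAdd a b) c) (TAdd (TLie a c) (TLie b c))
| LC_lieDr a b c :
    lie_congr (TLie a (TAdd b c)) (TAdd (TLie a b) (TLie a c))
| LC_liexx a : lie_congr (TLie a a) T0
| LC_lieJ a b c :
    lie_congr (TAdd (TAdd (TLie a (TLie b c)) (TLie b (TLie c a)))
                    (TLie c (TLie a b))) T0.

Definition lie_congrb (n : nat) : rel (lie_term n) :=
  fun a b => `[< lie_congr a b >].

Fact lie_congrb_refl n : reflexive (@lie_congrb n).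
Proof. by move=> a; apply/asboolP; exact: LC_refl. Qed.
Fact lie_congrb_sym n : symmetric (@lie_congrb n).
Proof. by move=> a b; apply/asboolP/asboolP; exact: LC_sym. Qed.
Fact lie_congrb_trans n : transitive (@lie_congrb n).
Proof.
by move=> b a c /asboolP ab /asboolP bc; apply/asboolP; exact: LC_trans bc.
Qed.
Canonical lie_congr_equiv n :=
  EquivRel (@lie_congrb n) (@lie_congrb_refl n) (@lie_congrb_sym n)
    (@lie_congrb_trans n).

Definition freeLie (n : nat) := {eq_quot (@lie_congrb n)}.
HB.instance Definition _ n := Choice.on (freeLie n).
HB.instance Definition _ n := EqQuotient.on (freeLie n).

Section FreeLie.
Variable n : nat.
Local Notation L := (freeLie n).
Local Notation cl a := (\pi_L a).

Lemma freeLie_eqP (a b : lie_term n) : (cl a) = (cl b) <-> lie_congr a b.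
Proof.
split; first by move/eqP; rewrite piE => /asboolP.
by move=> ab; apply/eqP; rewrite piE; apply/asboolP.
Qed.

Lemma freeLie_repr (a : lie_term n) : lie_congr (repr (cl a)) a.
Proof. by apply/freeLie_eqP; rewrite reprK. Qed.

Definition fl0 : L := (cl T0).
Definition flD (u v : L) : L := (cl (TAdd (repr u) (repr v))).
Definition flN (u : L) : L := (cl (TOpp (repr u))).
Definition flB (u v : L) : L := (cl (TLie (repr u) (repr v))).

Lemma flDE a b : flD (cl a) (cl b) = (cl (TAdd a b)).
Proof. by apply/freeLie_eqP/LC_add; exact: freeLie_repr. Qed.
Lemma flNE a : flN (cl a) = (cl (TOpp a)).
Proof. by apply/freeLie_eqP/LC_opp; exact: freeLie_repr. Qed.
Lemma flBE a b : flB (cl a) (cl b) = (cl (TLie a b)).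
Proof. by apply/freeLie_eqP/LC_lie; exact: freeLie_repr. Qed.

Fact flDA : associative flD.
Proof.
elim/quotW=> a; elim/quotW=> b; elim/quotW=> c.
by rewrite (flDE b c) (flDE a b) !flDE; apply/freeLie_eqP; exact: LC_addA.
Qed.
Fact flDC : commutative flD.
Proof.
elim/quotW=> a; elim/quotW=> b.
by rewrite !flDE; apply/freeLie_eqP; exact: LC_addC.
Qed.
Fact fl0D : left_id fl0 flD.
Proof. by elim/quotW=> a; rewrite flDE; apply/freeLie_eqP; exact: LC_add0. Qed.
Fact flND : left_inverse fl0 flN flD.
Proof.
by elim/quotW=> a; rewrite flNE flDE; apply/freeLie_eqP; exact: LC_addN.
Qed.
HB.instance Definition _ := GRing.isZmodule.Build L flDA flDC fl0D flND.

Lemma pi_T0 : (cl T0) = 0. Proof. by []. Qed.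
Lemma pi_TAdd a b : (cl (TAdd a b)) = (cl a) + (cl b).
Proof. by rewrite -flDE. Qed.
Lemma pi_TOpp a : (cl (TOpp a)) = - (cl a).
Proof. by rewrite -flNE. Qed.

Fact flBDl (u v w : L) : flB (u + v) w = flB u w + flB v w.
Proof.
elim/quotW: u => a; elim/quotW: v => b; elim/quotW: w => c.
by rewrite -pi_TAdd (flBE a c) (flBE b c) flBE -pi_TAdd; apply/freeLie_eqP;
   exact: LC_lieDl.
Qed.
Fact flBDr (u v w : L) : flB u (v + w) = flB u v + flB u w.
Proof.
elim/quotW: u => a; elim/quotW: v => b; elim/quotW: w => c.
by rewrite -pi_TAdd (flBE a b) (flBE a c) flBE -pi_TAdd; apply/freeLie_eqP;
   exact: LC_lieDr.
Qed.
Fact flBxx (u : L) : flB u u = 0.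
Proof.
by elim/quotW: u => a; rewrite flBE; apply/freeLie_eqP; exact: LC_liexx.
Qed.
Fact flBJ (u v w : L) :
  flB u (flB v w) + flB v (flB w u) + flB w (flB u v) = 0.
Proof.
elim/quotW: u => a; elim/quotW: v => b; elim/quotW: w => c.
rewrite (flBE b c) (flBE c a) (flBE a b) !flBE -!pi_TAdd.
by apply/freeLie_eqP; exact: LC_lieJ.
Qed.
HB.instance Definition _ := isLieRing.Build L flBDl flBDr flBxx flBJ.

Lemma pi_TLie a b : (cl (TLie a b)) = lie (cl a) (cl b).
Proof. by rewrite -flBE. Qed.

Definition flx (i : 'I_n) : L := (cl (TVar i)).

Lemma freeLie_ind (P : L -> Prop) :
    (forall i, P (flx i)) -> P 0 -> (forall u v, P u -> P v -> P (u + v)) ->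
    (forall u, P u -> P (- u)) -> (forall u v, P u -> P v -> P (lie u v)) ->
  forall u, P u.
Proof.
move=> Px P0 PD PN PB; elim/quotW; elim=> [i||a Pa b Pb|a Pa|a Pa b Pb] //.
- exact: Px.
- by rewrite pi_TAdd; exact: PD.
- by rewrite pi_TOpp; exact: PN.
- by rewrite pi_TLie; exact: PB.
Qed.

Section Lift.
Variables (g : lieRingType) (y : 'I_n -> g).

Fixpoint tlift (t : lie_term n) : g :=
  match t with
  | TVar i => y i
  | T0 => 0
  | TAdd a b => tlift a + tlift b
  | TOpp a => - tlift a
  | TLie a b => lie (tlift a) (tlift b)
  end.

Lemma tlift_congr a b : lie_congr a b -> tlift a = tlift b.
Proof.
elim=> {a b} //=; try congruence.
- by move=> *; rewrite addrA.
- by move=> *; rewrite addrC.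
- by move=> *; rewrite add0r.
- by move=> *; rewrite addNr.
- by move=> *; rewrite lieDl.
- by move=> *; rewrite lieDr.
- by move=> *; rewrite liexx.
- by move=> *; rewrite lieJ.
Qed.

Definition freeLie_lift (u : L) : g := tlift (repr u).

Lemma freeLie_liftE a : freeLie_lift (cl a) = tlift a.
Proof. exact/tlift_congr/freeLie_repr. Qed.

Theorem freeLie_universal : exists! f : L -> g,
  [/\ forall u v, f (u + v) = f u + f v,
      forall u v, f (lie u v) = lie (f u) (f v) &
      forall i, f (flx i) = y i].
Proof.
exists freeLie_lift; split=> [|f [fD fB fx]].
  split.
  - by elim/quotW=> a; elim/quotW=> b; rewrite -pi_TAdd !freeLie_liftE.
  - by elim/quotW=> a; elim/quotW=> b; rewrite -pi_TLie !freeLie_liftE.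
  - by move=> i; rewrite freeLie_liftE.
have f0 : f 0 = 0 by apply: (addrI (f 0)); rewrite -fD !addr0.
apply/funext; elim/quotW=> a; rewrite freeLie_liftE.
elim: a => [i||a IHa b IHb|a IHa|a IHa b IHb] /=.
- by rewrite -fx.
- by rewrite -f0.
- by rewrite pi_TAdd fD IHa IHb.
- by apply: (addIr (tlift a)); rewrite IHa pi_TOpp -fD !addNr f0.
- by rewrite pi_TLie fB IHa IHb.
Qed.

End Lift.

(* L_n(k); the left-normed brackets of length k in the generators span it. *)
Definition freeLie_wt (k : nat) : {pred L} :=
  zspan [set u | exists j : k.-tuple 'I_n, u = lnormed [seq flx l | l <- j]].
HB.instance Definition _ k := GRing.ZmodClosed.on (freeLie_wt k).

Lemma freeLie_wt1 i : flx i \in freeLie_wt 1.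
Proof. by apply: zspan_gen; exists [tuple i]. Qed.

Lemma freeLie_wt_liex k u i :
  (0 < k)%N -> u \in freeLie_wt k -> lie u (flx i) \in freeLie_wt k.+1.
Proof.
move=> k0; move: u; apply: zspan_ind => [u [j ->]||u v Hu Hv].
- apply: zspan_gen; exists [tuple of rcons j i].
  rewrite map_rcons lnormed_rcons //.
  by rewrite -size_eq0 size_map size_tuple -lt0n.
- by rewrite lie0r rpred0.
- by rewrite lieBl rpredB.
Qed.

Lemma freeLie_wtSP k u : (0 < k)%N -> u \in freeLie_wt k.+1 ->
  zspan_prop [set v | exists2 w, w \in freeLie_wt k & exists i, v = lie w (flx i)] u.
Proof.
move=> k0; move: u; apply: zspan_ind => [u [j ->]||u v Hu Hv]; last 2 first.
- exact: Zspan0.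
- exact: ZspanB.
apply: ZspanGen; case/tupleP: j => a j /=.
case: k k0 j => // k _ j; case: (lastP j) (size_tuple j) => // s b.
rewrite size_rcons => -[sk]; exists (lnormed [seq flx l | l <- a :: s]).
  by apply: zspan_gen; exists (@Tuple k.+1 _ (a :: s) (introT eqP (congr1 S sk))).
by exists b; rewrite -cats1 map_cat foldl_cat.
Qed.

Lemma freeLie_wtB k l u v : (0 < k)%N -> (0 < l)%N ->
  u \in freeLie_wt k -> v \in freeLie_wt l -> lie u v \in freeLie_wt (k + l).
Proof.
case: l => // l k0 _; elim: l k u v k0 => [|l IH] k u v k0 uk.
  move: v; apply: zspan_ind => [_ [j ->]||v w Hv Hw]; last 2 first.
  - by rewrite lier0 rpred0.
  - by rewrite lieBr rpredB.
  case/tupleP: j => a j; rewrite (tuple0 j) addn1 /=.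
  exact: freeLie_wt_liex.
move/(freeLie_wtSP (ltn0Sn l)); elim=> {v} [_ [w wl [i ->]]||v w _ Hv _ Hw].
- rewrite lie_assoc addnS rpredB //.
    by apply: freeLie_wt_liex; [rewrite addn_gt0 k0 | exact: IH].
  by rewrite -addSn IH // freeLie_wt_liex.
- by rewrite lier0 rpred0.
- by rewrite lieBr rpredB.
Qed.

End FreeLie.

(* H^* (x) L_n = Hom(H, L_n), with sum_i x_i^* (x) C_i the function i |-> C_i. *)
Definition lieHom (n : nat) := {ffun 'I_n -> freeLie n}.
HB.instance Definition _ n := GRing.Zmodule.on (lieHom n).

Section Derivation.
Variable n : nat.
Local Notation L := (freeLie n).
Local Notation cl a := (\pi_L a).
Implicit Types (f g h : lieHom n) (u v w : L).

Fixpoint tder f (t : lie_term n) : L :=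
  match t with
  | TVar i => f i
  | T0 => 0
  | TAdd a b => tder f a + tder f b
  | TOpp a => - tder f a
  | TLie a b => lie (tder f a) (cl b) + lie (cl a) (tder f b)
  end.

Lemma tder_congr f a b : lie_congr a b -> tder f a = tder f b.
Proof.
elim=> {a b} //=; try congruence.
- move=> a a' b b' /freeLie_eqP -> -> /freeLie_eqP -> -> //.
- by move=> *; rewrite addrA.
- by move=> *; rewrite addrC.
- by move=> *; rewrite add0r.
- by move=> *; rewrite addNr.
- by move=> *; rewrite pi_TAdd !lieDl addrACA.
- by move=> *; rewrite pi_TAdd !lieDr addrACA.
- by move=> a; rewrite [X in _ + X]lieC subrr.
- move=> a b c; rewrite !pi_TLie !lieDr.
  set A := (cl a); set B := (cl b); set C := (cl c).
  set A' := tder f a; set B' := tder f b; set C' := tder f c.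
  have := lieJ A' B C; have := lieJ A B' C; have := lieJ A B C' => J3 J2 J1.
  rewrite (AC ((1*2)*(1*2)*(1*2)) ((1*6*8)*(2*4*9)*(3*5*7))) /=.
  by rewrite J1 J2 J3 !addr0.
Qed.

(* The derivation of L_n extending f. *)
Definition der f u : L := tder f (repr u).

Lemma derE f a : der f (cl a) = tder f a.
Proof. exact/tder_congr/freeLie_repr. Qed.
Lemma der_flx f i : der f (flx i) = f i.
Proof. by rewrite derE. Qed.
Lemma der0 f : der f 0 = 0.
Proof. by rewrite -pi_T0 derE. Qed.
Lemma derD f u v : der f (u + v) = der f u + der f v.
Proof.
by elim/quotW: u => a; elim/quotW: v => b; rewrite -pi_TAdd !derE.
Qed.
Lemma derN f u : der f (- u) = - der f u.
Proof. by elim/quotW: u => a; rewrite -pi_TOpp !derE. Qed.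
Lemma derB f u v : der f (u - v) = der f u - der f v.
Proof. by rewrite derD derN. Qed.
Lemma der_lie f u v : der f (lie u v) = lie (der f u) v + lie u (der f v).
Proof.
by elim/quotW: u => a; elim/quotW: v => b; rewrite -pi_TLie !derE.
Qed.
Lemma der_sum f (I : Type) (r : seq I) (F : I -> L) :
  der f (\sum_(i <- r) F i) = \sum_(i <- r) der f (F i).
Proof. exact: (big_morph _ (derD f) (der0 f)). Qed.

Lemma der_addf f g u : der (f + g) u = der f u + der g u.
Proof.
elim/freeLie_ind: u => [i||u v IHu IHv|u IHu|u v IHu IHv].
- by rewrite !der_flx ffunE.
- by rewrite !der0 addr0.
- by rewrite !derD IHu IHv addrACA.
- by rewrite !derN IHu opprD.
- by rewrite !der_lie IHu IHv lieDl lieDr addrACA.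
Qed.

(* [f, g] = g o f - f o g as derivations, see der_bracketE. *)
Definition der_bracket f g : lieHom n :=
  [ffun i => der g (f i) - der f (g i)].

Lemma der_bracketE f g u :
  der (der_bracket f g) u = der g (der f u) - der f (der g u).
Proof.
elim/freeLie_ind: u => [i||u v IHu IHv|u IHu|u v IHu IHv].
- by rewrite !der_flx ffunE.
- by rewrite !der0 subrr.
- by rewrite !derD IHu IHv opprD addrACA.
- by rewrite !derN IHu opprD.
- rewrite !der_lie IHu IHv !derD !der_lie lieBl lieBr opprD.
  rewrite !opprD [RHS](AC ((2*2)*(2*2)) ((1*5)*(4*8)*((2*7)*(3*6)))) /=.
  by rewrite !subrr !addr0.
Qed.

Fact der_bracketDl f g h :
  der_bracket (f + g) h = der_bracket f h + der_bracket g h.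
Proof.
by apply/ffunP=> i; rewrite !ffunE derD der_addf opprD addrACA.
Qed.
Fact der_bracketDr f g h :
  der_bracket f (g + h) = der_bracket f g + der_bracket f h.
Proof.
by apply/ffunP=> i; rewrite !ffunE derD der_addf opprD addrACA.
Qed.
Fact der_bracketxx f : der_bracket f f = 0.
Proof. by apply/ffunP=> i; rewrite !ffunE subrr. Qed.
Fact der_bracketJ f g h :
  der_bracket f (der_bracket g h) + der_bracket g (der_bracket h f)
    + der_bracket h (der_bracket f g) = 0.
Proof.
apply/ffunP=> i; rewrite !ffunE !der_bracketE !derB !opprB.
rewrite (AC (((2*2)*(2*2))*(2*2)) ((1*12)*(7*2)*(3*10)*(5*4)*(11*6)*(9*8))) /=.
by rewrite !subrr !addr0.
Qed.
HB.instance Definition _ := isLieRing.Build (lieHom n)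
  der_bracketDl der_bracketDr der_bracketxx der_bracketJ.

End Derivation.

Section BraidLie.
Variable n : nat.
Local Notation L := (freeLie n).
Implicit Types (f g : lieHom n) (k l : nat).

(* x_i^* (x) u *)
Definition hom1 (i : 'I_n) (u : L) : lieHom n :=
  [ffun m => if m == i then u else 0].

Definition p_mod k : {pred lieHom n} :=
  zspan [set f | exists (i : 'I_n) (j : k.-tuple 'I_n),
    f = hom1 i (lnormed (rcons [seq flx m | m <- j] (flx i)))].
HB.instance Definition _ k := GRing.ZmodClosed.on (p_mod k).

Definition b_mod k : {pred lieHom n} :=
  [pred f | (f \in p_mod k) && (\sum_(i < n) f i == 0)].

(* The sum of the b_n(k), k >= 1, inside Hom(H, L_n); by p_mod_wt the k-th
   summand consists of maps H -> L_n(k+1). *)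
Definition b_alg : {pred lieHom n} :=
  zspan [set f | exists2 k, (0 < k)%N & f \in b_mod k].
HB.instance Definition _ := GRing.ZmodClosed.on b_alg.

Fact hom1B i : zmod_morphism (hom1 i).
Proof. by move=> u v; apply/ffunP=> m; rewrite !ffunE; case: eqP; rewrite ?subr0. Qed.
HB.instance Definition _ i := GRing.isZmodMorphism.Build L (lieHom n) (hom1 i) (hom1B i).

Lemma p_modP k f : (0 < k)%N ->
  f \in p_mod k <-> exists u : 'I_n -> L,
    (forall i, u i \in freeLie_wt k) /\ forall i, f i = lie (u i) (flx i).
Proof.
move=> k0; split.
  move: f; apply: zspan_ind => [_ [i [j ->]]||f g [u [uk uf]] [v [vk vg]]].
  - exists (fun m => if m == i then lnormed [seq flx m | m <- j] else 0).
    split=> m; last first.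
      rewrite ffunE; case: eqP => [->|_]; last by rewrite lie0r.
      by rewrite lnormed_rcons // -size_eq0 size_map size_tuple -lt0n.
    by case: eqP => _; [apply: zspan_gen; exists j | exact: rpred0].
  - by exists (fun=> 0); split=> i; rewrite ?rpred0 // ffunE lie0r.
  - exists (fun i => u i - v i); split=> i; first by rewrite rpredB.
    by rewrite !ffunE uf vg lieBl.
move=> [u [uk uf]].
have -> : f = \sum_i hom1 i (lie (u i) (flx i)).
  apply/ffunP=> m; rewrite sum_ffunE (bigD1 m) //= ffunE eqxx big1 ?addr0 //.
  by move=> i im; rewrite ffunE eq_sym (negPf im).
apply: rpred_sum => i _; move: (u i) (uk i).
apply: zspan_ind => [_ [j ->]||v w Hv Hw].
- apply: zspan_gen; exists i, j.
  by rewrite lnormed_rcons // -size_eq0 size_map size_tuple -lt0n.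
- by rewrite lie0r raddf0 rpred0.
- by rewrite lieBl raddfB rpredB.
Qed.

Lemma p_mod_wt k f i :
  (0 < k)%N -> f \in p_mod k -> f i \in freeLie_wt k.+1.
Proof.
move=> k0 /(p_modP _ k0)[u [uk ->]]; exact: freeLie_wt_liex.
Qed.

Lemma der_p_mod k l f u : (0 < k)%N -> (0 < l)%N ->
  f \in p_mod k -> u \in freeLie_wt l -> der f u \in freeLie_wt (k + l).
Proof.
case: l => // l k0 _ fk.
have fx i : f i \in freeLie_wt k.+1 by exact: p_mod_wt.
elim: l u => [|l IH] u.
  move: u; apply: zspan_ind => [_ [j ->]||u w Hu Hw].
  - case/tupleP: j => a j; rewrite (tuple0 j) addn1 /= der_flx; exact: fx.
  - by rewrite der0 rpred0.
  - by rewrite derB rpredB.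
move/(freeLie_wtSP (ltn0Sn l)); elim=> {u} [_ [w wl [i ->]]||u w _ Hu _ Hw].
- rewrite der_lie der_flx addnS rpredD //.
    by apply: freeLie_wt_liex; [rewrite addn_gt0 k0 | exact: IH].
  by rewrite -addSn addnC; apply: freeLie_wtB.
- by rewrite der0 rpred0.
- by rewrite derB rpredB.
Qed.

Lemma p_mod_lie k l f g : (0 < k)%N -> (0 < l)%N ->
  f \in p_mod k -> g \in p_mod l -> lie f g \in p_mod (k + l).
Proof.
move=> k0 l0 fk gl; apply/p_modP; first by rewrite addn_gt0 k0.
have [u [uk uf]] := (p_modP _ k0).1 fk; have [v [vl vg]] := (p_modP _ l0).1 gl.
exists (fun i => der g (u i) - der f (v i) + lie (u i) (v i)); split=> i.
  rewrite rpredD ?freeLie_wtB // rpredB //; last exact: der_p_mod.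
  by rewrite addnC; exact: der_p_mod.
rewrite [LHS]ffunE uf vg !der_lie !der_flx uf vg lieDl lieBl.
rewrite (lie_assoc (u i) (v i)) (lieC (lie (u i) _) (v i)) opprK opprD.
by rewrite (AC ((1*2)*2) ((1*4*2)*(3*5))) /= subrr addr0.
Qed.

Lemma b_mod_lie k l f g : (0 < k)%N -> (0 < l)%N ->
  f \in b_mod k -> g \in b_mod l -> lie f g \in b_mod (k + l).
Proof.
move=> k0 l0 /andP[fk /eqP f0] /andP[gl /eqP g0]; apply/andP.
split; first exact: p_mod_lie.
under eq_bigr do rewrite ffunE.
by rewrite sumrB -!der_sum f0 g0 !der0 subrr.
Qed.

Lemma b_alg_lie f g : f \in b_alg -> g \in b_alg -> lie f g \in b_alg.
Proof.
move=> fb; move: g; apply: zspan_ind => [g [l l0 gl]||g h Hg Hh].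
- move: f fb; apply: zspan_ind => [f [k k0 fk]||f h Hf Hh].
  + apply: zspan_gen; exists (k + l)%N; first by rewrite addn_gt0 k0.
    exact: b_mod_lie.
  + by rewrite lie0r rpred0.
  + by rewrite lieBl rpredB.
- by rewrite lier0 rpred0.
- by rewrite lieBr rpredB.
Qed.

Definition bLie := {f : lieHom n | f \in b_alg}.
HB.instance Definition _ := SubChoice.on bLie.
HB.instance Definition _ := [SubChoice_isSubZmodule of bLie by <:].

Definition bLie_lie (a b : bLie) : bLie :=
  exist _ (lie (val a) (val b)) (b_alg_lie (valP a) (valP b)).

Fact bLie_lieDl a b c : bLie_lie (a + b) c = bLie_lie a c + bLie_lie b c.
Proof. by apply: val_inj; rewrite /= lieDl. Qed.
Fact bLie_lieDr a b c : bLie_lie a (b + c) = bLie_lie a b + bLie_lie a c.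
Proof. by apply: val_inj; rewrite /= lieDr. Qed.
Fact bLie_liexx a : bLie_lie a a = 0.
Proof. by apply: val_inj; rewrite /= liexx. Qed.
Fact bLie_lieJ a b c :
  bLie_lie a (bLie_lie b c) + bLie_lie b (bLie_lie c a)
    + bLie_lie c (bLie_lie a b) = 0.
Proof. by apply: val_inj; rewrite /= lieJ. Qed.
HB.instance Definition _ :=
  isLieRing.Build bLie bLie_lieDl bLie_lieDr bLie_liexx bLie_lieJ.

(* The degree k part of H_1(b_n, Z): the image of b_n(k). *)
Definition bH1_deg k : {pred lieH1 bLie} :=
  [pred h | `[< exists2 a : bLie, val a \in b_mod k & h = lie_ab a >]].

End BraidLie.
Arguments p_mod : clear implicits.
Arguments b_mod : clear implicits.
Arguments b_alg : clear implicits.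
Arguments bH1_deg : clear implicits.

(* Main.v *)
Require Import Defs.
From HB Require Import structures.
From mathcomp Require Import all_boot all_order all_algebra.
From mathcomp Require Import boolp classical_sets.
From mathcomp Require Import mpoly ring zify.

Set Implicit Arguments.
Unset Strict Implicit.
Unset Printing Implicit Defensive.

Import Order.TTheory GRing.Theory Num.Theory.
Local Open Scope ring_scope.

(** The lower bound comes from a map on the abelianization with large image, the
    divergence, which is Morita's trace.  Let [S] be the polynomial ring
    Z[x_1, ..., x_n].  The free Lie algebra maps to the semidirect product of [S]
    and [S^n], and the [S^n]-components of this map are abelianized Fox derivatives
    [fox j].  Derivations of positive degree act trivially on [S], so the chain
    rule [fox_der] shows that the Jacobian matrix [fox j (f i)] of a bracket of
    two such derivations is a commutator of matrices.  Its trace [dvg] therefore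
    vanishes on brackets, and classes in the abelianization are independent as
    soon as their divergences are ([zindep_lie_ab]).

    Elements of b_n(k) with computable divergence come from trivalent trees with
    [k+1] leaves labelled by generators: sum over the leaves the tree rooted at
    that leaf, paired with the label of the leaf.  The Jacobi identity at each
    inner node puts this derivation in b_n(k).  Cutting an edge of the tree gives
    two rooted trees [A] and [B], and if both have at least two leaves then
    the divergence is (+-) 2 times the sum of x_i (fox i A) (fox i B)
    ([dvg_edge_der]); the factor 2 needs [k] odd, as for [k] even the contributions
    of the two sides cancel.

    For [A = [x_a, x_p]] and [B = [x_a, x_q, w]] this reaches, up to the factor 2,
    every monomial of degree [k] with three distinct letters, and all the binomials
    x_i x_p (x_i + x_p) w.  Modulo these a monomial in the two letters
    [x_i, x_p] is determined up to sign by the pair, so that the n(n+1)/2 monomials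
    x_i x_p^(k-1) with [i <= p] span what remains of degree [k]
    ([dvg_mod_spareX]).  Counting monomials gives at least
    C(n+k-1, k) - n(n+1)/2 independent classes ([bH1_deg_zindep]).

    The rank of the degree [k] part is finite because it is a quotient of a
    submodule of the finitely generated module p_n(k) ([bH1_deg_rank_bounded]).
    The abelianization itself is not finitely generated since the number of
    independent classes found in degree [k] is unbounded as [k] grows. *)

(** * Rank of a module over the integers *)

Lemma zspan_seqP (V : zmodType) (s : seq V) (v : V) :
  v \in zspan [set` s] -> exists c : 'I_(size s) -> int,
    v = \sum_(j < size s) s`_j *~ c j.
Proof.
move: v; apply: zspan_ind => [v /= vs||u v [c ->] [d ->]].
- exists (fun j => (j == index v s :> nat)%:R).
  have lt_v : (index v s < size s)%N by rewrite index_mem.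
  rewrite (bigD1 (Ordinal lt_v)) //= eqxx mulr1z nth_index // big1 ?addr0 //.
  by move=> j; rewrite -val_eqE /= => /negPf ->; rewrite mulr0z.
- by exists (fun=> 0); rewrite big1 // => j _; rewrite mulr0z.
- exists (fun j => c j - d j); rewrite -sumrB.
  by apply: eq_bigr => j _; rewrite mulrzBr.
Qed.

(** The Smith form turns the last rows of a tall matrix into zero rows by a
    unimodular change of basis. *)
Lemma int_row_kernel (m r : nat) (M : 'M[int]_(m, r)) :
  (r < m)%N -> exists2 c : 'rV[int]_m, c != 0 & c *m M = 0.
Proof.
case: m M => // m M; rewrite ltnS => le_rm.
have [U Uunit [W _ [d _ defM]]] := int_Smith_normal_form M.
exists (row ord_max (invmx U)).
  apply: contra_neq (oner_neq0 int) => Ui0.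
  have := congr1 (fun A : 'M[int]_(1, m.+1) => (A *m U) 0 ord_max) Ui0.
  by rewrite mul0mx -row_mul mulVmx // !mxE eqxx.
rewrite defM -row_mul !mulmxA mulVmx // mul1mx row_mul.
suff -> : row ord_max (\matrix_(i < m.+1, j < r) (d`_i *+ (i == j :> nat))) = 0.
  by rewrite mul0mx.
apply/rowP=> j; rewrite !mxE /= gtn_eqF ?mulr0n //.
exact: leq_trans (ltn_ord j) le_rm.
Qed.

(** More vectors than generators: the matrix of coordinates has a relation
    between its rows. *)
Lemma zindep_le_size (V : zmodType) (s : seq V) (m : nat) (v : 'I_m -> V) :
  (forall i, v i \in zspan [set` s]) -> zindep v -> (m <= size s)%N.
Proof.
move=> vs v_indep; rewrite leqNgt; apply/negP => lt_sm.
have [c defv] := boolp.choice (fun i => zspan_seqP (vs i)).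
have [a /eqP a_neq0 aM0] := int_row_kernel (\matrix_(i, j) c i j) lt_sm.
apply: a_neq0; apply/rowP=> i; rewrite mxE; move: i; apply: (v_indep (a 0)).
under eq_bigr do rewrite defv mulrz_suml.
rewrite exchange_big big1 // => j _.
under eq_bigr do rewrite -mulrzA mulrC.
rewrite -mulrz_sumr; have /rowP/(_ j) := aM0; rewrite !mxE.
by under eq_bigr do rewrite mxE; move=> ->; rewrite mulr0z.
Qed.

Lemma zindep_lift (V W : zmodType) (f : {additive V -> W}) (m : nat)
    (v : 'I_m -> V) (w : 'I_m -> W) :
  (forall i, f (v i) = w i) -> zindep w -> zindep v.
Proof.
move=> fv w_indep c vc0; apply: w_indep; rewrite -[RHS](raddf0 f) -vc0 raddf_sum.
by apply: eq_bigr => i _; rewrite raddfMz fv.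
Qed.

(** The bound [N] ensures that the rank is finite: [zrank] is 0 otherwise. *)
Lemma zrank_ge (V : zmodType) (A : {pred V}) (r N : nat) (v : 'I_r -> V) :
    (forall i, v i \in A) -> zindep v ->
    (forall m (w : 'I_m -> V), (forall i, w i \in A) -> zindep w -> (m <= N)%N) ->
  (r <= zrank A)%N.
Proof.
move=> vA v_indep le_N.
pose P m := `[< exists w : 'I_m -> V, (forall i, w i \in A) /\ zindep w >].
have exP : exists m, P m by exists r; apply/asboolP; exists v.
have leP m : P m -> (m <= N)%N by case/asboolP=> w [wA]; exact: le_N.
have maxP m (w : 'I_m -> V) : (forall i, w i \in A) -> zindep w -> P m.
  by move=> wA w_indep; apply/asboolP; exists w.
have [m /asboolP Pm m_max] := ex_maxnP exP leP.
rewrite (@zrankE _ _ m); first exact: m_max (maxP _ _ vA v_indep).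
by split=> // l w wA w_indep; apply: m_max (maxP _ _ wA w_indep).
Qed.

(** * The metabelian Magnus representation *)

Section Magnus.
Variable n : nat.
Local Notation S := {mpoly int[n]}.
Local Notation L := (freeLie n).

(** The semidirect product of the abelian Lie ring [S] with the [S]-module
    [S^n]: a Lie model of the Magnus embedding of the free metabelian group. *)
Definition magnus := (S * {ffun 'I_n -> S})%type.
HB.instance Definition _ := GRing.Zmodule.on magnus.

Definition magnus_lie (a b : magnus) : magnus :=
  (0, [ffun j => a.1 * b.2 j - b.1 * a.2 j]).

Fact magnus_lieDl a b c :
  magnus_lie (a + b) c = magnus_lie a c + magnus_lie b c.
Proof.
congr pair; first by rewrite /= addr0.
by apply/ffunP=> j; rewrite !ffunE /=; ring.
Qed.

Fact magnus_lieDr a b c :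
  magnus_lie a (b + c) = magnus_lie a b + magnus_lie a c.
Proof.
congr pair; first by rewrite /= addr0.
by apply/ffunP=> j; rewrite !ffunE /=; ring.
Qed.

Fact magnus_liexx a : magnus_lie a a = 0.
Proof. by congr pair; apply/ffunP=> j; rewrite !ffunE subrr. Qed.

Fact magnus_lieJ a b c :
  magnus_lie a (magnus_lie b c) + magnus_lie b (magnus_lie c a)
    + magnus_lie c (magnus_lie a b) = 0.
Proof.
congr pair; first by rewrite /= !addr0.
by apply/ffunP=> j; rewrite !ffunE /=; ring.
Qed.
HB.instance Definition _ :=
  isLieRing.Build magnus magnus_lieDl magnus_lieDr magnus_liexx magnus_lieJ.

Definition magnus_map : L -> magnus :=
  freeLie_lift (fun i => ('X_i, [ffun j => (i == j)%:R]) : magnus).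

Lemma magnus_mapD u v : magnus_map (u + v) = magnus_map u + magnus_map v.
Proof.
elim/quotW: u => a; elim/quotW: v => b.
by rewrite -pi_TAdd /magnus_map !freeLie_liftE.
Qed.

Lemma magnus_map_lie u v :
  magnus_map (lie u v) = lie (magnus_map u) (magnus_map v).
Proof.
elim/quotW: u => a; elim/quotW: v => b.
by rewrite -pi_TLie /magnus_map !freeLie_liftE.
Qed.

Lemma magnus_map_flx i :
  magnus_map (flx i) = ('X_i, [ffun j => (i == j)%:R]).
Proof. by rewrite /magnus_map freeLie_liftE. Qed.

Definition ab (u : L) : S := (magnus_map u).1.

(** The abelianization of the Fox derivative with respect to [x_j]. *)
Definition fox (j : 'I_n) (u : L) : S := (magnus_map u).2 j.

Fact magnus_map_zmod_morphism : zmod_morphism magnus_map.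
Proof.
move=> u v; apply: (addIr (magnus_map v)).
by rewrite -magnus_mapD !subrK.
Qed.
HB.instance Definition _ :=
  GRing.isZmodMorphism.Build L magnus magnus_map magnus_map_zmod_morphism.

Fact ab_zmod_morphism : zmod_morphism ab.
Proof. by move=> u v; rewrite /ab raddfB. Qed.
HB.instance Definition _ := GRing.isZmodMorphism.Build L S ab ab_zmod_morphism.

Fact fox_zmod_morphism j : zmod_morphism (fox j).
Proof. by move=> u v; rewrite /fox raddfB !ffunE. Qed.
HB.instance Definition _ j :=
  GRing.isZmodMorphism.Build L S (fox j) (fox_zmod_morphism j).

Lemma ab_lie u v : ab (lie u v) = 0.
Proof. by rewrite /ab magnus_map_lie. Qed.

Lemma ab_flx i : ab (flx i) = 'X_i.
Proof. by rewrite /ab magnus_map_flx. Qed.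

Lemma fox_lie j u v : fox j (lie u v) = ab u * fox j v - ab v * fox j u.
Proof. by rewrite /fox magnus_map_lie ffunE. Qed.

Lemma fox_flx j i : fox j (flx i) = (i == j)%:R.
Proof. by rewrite /fox magnus_map_flx ffunE. Qed.

(** * The divergence *)

Implicit Types f g : lieHom n.

Definition dvg f : S := \sum_i fox i (f i).

Fact dvg_zmod_morphism : zmod_morphism dvg.
Proof.
by move=> f g; rewrite /dvg -sumrB; apply: eq_bigr => i _; rewrite !ffunE raddfB.
Qed.
HB.instance Definition _ :=
  GRing.isZmodMorphism.Build (lieHom n) S dvg dvg_zmod_morphism.

(** A derivation of positive degree takes its values in the derived algebra. *)
Lemma ab_der f u : (forall i, ab (f i) = 0) -> ab (der f u) = 0.
Proof.
move=> f0; elim/freeLie_ind: u => [i||u v IHu IHv|u IHu|u v _ _].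
- by rewrite der_flx.
- by rewrite der0 raddf0.
- by rewrite derD raddfD /= IHu IHv addr0.
- by rewrite derN raddfN /= IHu oppr0.
- by rewrite der_lie raddfD /= !ab_lie addr0.
Qed.

(** Chain rule: a derivation of positive degree acts trivially on the
    coefficients in [S], so it acts on Fox derivatives through its Jacobian. *)
Lemma fox_der f j u : (forall i, ab (f i) = 0) ->
  fox j (der f u) = \sum_i fox i u * fox j (f i).
Proof.
move=> f0; elim/freeLie_ind: u => [i||u v IHu IHv|u IHu|u v IHu IHv].
- rewrite der_flx (bigD1 i) //= fox_flx eqxx mul1r big1 ?addr0 // => m.
  by rewrite fox_flx eq_sym => /negPf ->; rewrite mul0r.
- by rewrite der0 raddf0 big1 // => i _; rewrite raddf0 mul0r.
- rewrite derD raddfD /= IHu IHv -big_split /=; apply: eq_bigr => i _.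
  by rewrite raddfD mulrDl.
- rewrite derN raddfN /= IHu -sumrN; apply: eq_bigr => i _.
  by rewrite raddfN mulNr.
- rewrite der_lie raddfD /= !fox_lie !ab_der // !mul0r add0r subr0 addrC.
  rewrite IHu IHv !mulr_sumr -sumrB; apply: eq_bigr => i _.
  by rewrite fox_lie; ring.
Qed.

(** By the chain rule this is the trace of a commutator of Jacobians. *)
Lemma dvg_lie f g : (forall i, ab (f i) = 0) -> (forall i, ab (g i) = 0) ->
  dvg (lie f g) = 0.
Proof.
move=> f0 g0; rewrite /dvg.
under eq_bigr do rewrite ffunE raddfB /= !fox_der //.
rewrite sumrB [X in X - _]exchange_big /= -sumrB big1 // => i _.
by rewrite -sumrB big1 // => j _; rewrite mulrC subrr.
Qed.

Lemma ab_b_alg f i : f \in b_alg n -> ab (f i) = 0.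
Proof.
move: f; apply: zspan_ind => [f [k k0 /andP[fk _]]||f g IHf IHg].
- by have [u [_ ->]] := (p_modP _ k0).1 fk; rewrite ab_lie.
- by rewrite ffunE raddf0.
- by rewrite !ffunE raddfB /= IHf IHg subrr.
Qed.

Lemma dvg_derived (a : bLie n) : a \in @lie_derived (bLie n) -> dvg (val a) = 0.
Proof.
move: a; apply: zspan_ind => [_ [a [b ->]]||a b IHa IHb].
- by apply: dvg_lie => i; apply: ab_b_alg (valP _).
- by rewrite !raddf0.
- by rewrite (raddfB val) raddfB /= IHa IHb subrr.
Qed.

(** The divergence kills the derived subalgebra, so a relation between classes
    holds between divergences. *)
Lemma zindep_lie_ab (m : nat) (a : 'I_m -> bLie n) :
  zindep (fun i => dvg (val (a i))) -> zindep (fun i => lie_ab (a i)).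
Proof.
move=> dvg_indep c ac0; apply: dvg_indep.
have : \sum_i a i *~ c i \in @lie_derived (bLie n).
  rewrite -lie_ab_eq0 raddf_sum /=; apply/eqP; rewrite -[RHS]ac0.
  apply: eq_bigr => i _.
  by rewrite raddfMz.
move/dvg_derived => dvg0; rewrite -[RHS]dvg0 !raddf_sum.
by apply: eq_bigr => i _; rewrite (raddfMz val) raddfMz.
Qed.

End Magnus.

(** * Derivations attached to trees *)

Section Trees.
Variable n : nat.
Local Notation S := {mpoly int[n]}.
Local Notation L := (freeLie n).

Inductive lie_tree : Type :=
| Leaf of 'I_n
| Node of lie_tree & lie_tree.

Fixpoint tree_lie (T : lie_tree) : L :=
  match T with
  | Leaf i => flx i
  | Node A B => lie (tree_lie A) (tree_lie B)
  end.

Fixpoint leaves (T : lie_tree) : nat :=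
  match T with
  | Leaf _ => 1
  | Node A B => leaves A + leaves B
  end.

(** The sum over the leaves [l] of [T], labelled by [x_i], of the derivations
    [x_i^* (x) [t_l, x_i]], where [t_l] is the tree obtained from [T] by grafting
    [u] at the root of [T] and moving the root to [l]. *)
Fixpoint tree_der (T : lie_tree) (u : L) : lieHom n :=
  match T with
  | Leaf i => hom1 i (lie u (flx i))
  | Node A B => tree_der A (lie (tree_lie B) u) + tree_der B (lie u (tree_lie A))
  end.

(** The sum over all the leaves of the unrooted tree made of [A] and [B] with an
    edge joining their roots. *)
Definition edge_der (A B : lie_tree) : lieHom n :=
  tree_der A (tree_lie B) + tree_der B (tree_lie A).

Fact b_mod_zmod_closed k : zmod_closed (b_mod n k).
Proof.
split=> [|f g /andP[fk /eqP f0] /andP[gk /eqP g0]]; apply/andP; split.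
- exact: rpred0.
- by rewrite big1 // => i _; rewrite ffunE.
- exact: rpredB.
- by under eq_bigr do rewrite !ffunE; rewrite sumrB f0 g0 subrr.
Qed.
HB.instance Definition _ k :=
  GRing.isZmodClosed.Build (lieHom n) (b_mod n k) (b_mod_zmod_closed k).

Lemma leaves_gt0 T : (0 < leaves T)%N.
Proof. by elim: T => //= A A0 B B0; rewrite addn_gt0 A0. Qed.

Lemma tree_lie_wt T : tree_lie T \in freeLie_wt (leaves T).
Proof.
elim: T => [i|A IHA B IHB] /=; first exact: freeLie_wt1.
exact: freeLie_wtB (leaves_gt0 A) (leaves_gt0 B) IHA IHB.
Qed.

Lemma tree_der_p_mod T u k l : (0 < l)%N -> u \in freeLie_wt l ->
  (leaves T + l)%N = k.+1 -> tree_der T u \in p_mod n k.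
Proof.
move=> l0 ul Tlk; have k0 : (0 < k)%N.
  by have := leaves_gt0 T; move: Tlk l0; lia.
elim: T u l l0 ul Tlk => [i|A IHA B IHB] u l l0 ul /= Tlk.
  apply/(p_modP _ k0); exists (fun j => if j == i then u else 0).
  split=> j; last by rewrite ffunE; case: eqP => [->|_]; rewrite ?lie0r.
  by case: eqP => _; rewrite ?rpred0 //; move: Tlk; rewrite add1n => -[<-].
have A0 := leaves_gt0 A; have B0 := leaves_gt0 B.
apply: rpredD.
  apply: (IHA _ (leaves B + l)%N); [lia | | lia].
  exact: freeLie_wtB B0 l0 (tree_lie_wt B) ul.
apply: (IHB _ (l + leaves A)%N); [lia | | lia].
exact: freeLie_wtB l0 A0 ul (tree_lie_wt A).
Qed.

(** By induction on [T], the step being the Jacobi identity at a node. *)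
Lemma sum_tree_der T u : \sum_i tree_der T u i = lie u (tree_lie T).
Proof.
elim: T u => [i|A IHA B IHB] u /=.
  rewrite (bigD1 i) //= ffunE eqxx big1 ?addr0 // => j ji.
  by rewrite ffunE (negPf ji).
under eq_bigr do rewrite ffunE.
rewrite big_split /= IHA IHB [RHS]lie_assoc addrC; congr (_ + _).
by rewrite (lieC (tree_lie B)) lieNl.
Qed.

Lemma edge_der_b_mod A B k :
  (leaves A + leaves B)%N = k.+1 -> edge_der A B \in b_mod n k.
Proof.
move=> ABk; apply/andP; split.
  apply: rpredD.
    exact: tree_der_p_mod (leaves_gt0 B) (tree_lie_wt B) ABk.
  by apply: tree_der_p_mod (leaves_gt0 A) (tree_lie_wt A) _; rewrite addnC.
under eq_bigr do rewrite ffunE.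
by rewrite big_split /= !sum_tree_der lieC addNr.
Qed.

(** Either [T] is a single leaf or its [ab] vanishes. *)
Lemma sign_ab_tree T : (-1) ^+ leaves T * ab (tree_lie T) = - ab (tree_lie T).
Proof. by case: T => [i|A B] /=; rewrite ?expr1 ?mulN1r // ab_lie mulr0 oppr0. Qed.

(** Descending past a node brackets [u] with the sibling subtree, which multiplies
    the Fox derivatives of [u] by the [ab] of that subtree. The Fox derivatives of
    the whole tree have the same factor with the opposite sign. Since it vanishes
    unless the sibling is a leaf, there is one sign for each leaf. *)
Lemma dvg_tree_der T u : ab u = 0 ->
  dvg (tree_der T u)
    = (-1) ^+ leaves T * \sum_i 'X_i * fox i (tree_lie T) * fox i u.
Proof.
elim: T u => [i|A IHA B IHB] u u0.
  rewrite /dvg (bigD1 i) //= ffunE eqxx big1 => [|j ji]; last first.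
    by rewrite ffunE (negPf ji) raddf0.
  rewrite [in RHS](bigD1 i) //= big1 => [|j ji]; last first.
    by rewrite fox_flx eq_sym (negPf ji) mulr0 mul0r.
  rewrite fox_lie u0 ab_flx /= fox_flx eqxx mulr1n; ring.
rewrite [tree_der _ _]/= raddfD /= IHA ?ab_lie // IHB ?ab_lie //.
rewrite !mulr_sumr -big_split /=; apply: eq_bigr => i _.
rewrite !fox_lie u0 exprD.
have sA := sign_ab_tree A; have sB := sign_ab_tree B.
set a := ab (tree_lie A) in sA *; set b := ab (tree_lie B) in sB *.
set s := (-1) ^+ leaves A in sA *; set t := (-1) ^+ leaves B in sB *.
set X := 'X_i; set y := fox i u.
set p := fox i (tree_lie A); set q := fox i (tree_lie B).
transitivity (s * X * p * y * b - t * X * q * y * a); first by ring.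
transitivity ((s * a) * t * X * q * y - (t * b) * s * X * p * y); last by ring.
by rewrite sA sB; ring.
Qed.

(** The two halves of [edge_der] carry the signs of [leaves A] and [leaves B], which
    have the same parity because [k] is odd; hence the factor 2. *)
Lemma dvg_edge_der A B k : odd k -> (leaves A + leaves B)%N = k.+1 ->
    ab (tree_lie A) = 0 -> ab (tree_lie B) = 0 ->
  dvg (edge_der A B) = (-1) ^+ leaves A *
    (2 * \sum_i 'X_i * fox i (tree_lie A) * fox i (tree_lie B)).
Proof.
move=> odd_k ABk A0 B0; rewrite raddfD /= !dvg_tree_der //.
have -> : (-1) ^+ leaves B = (-1) ^+ leaves A :> S.
  rewrite -signr_odd -[RHS]signr_odd; congr (_ ^+ nat_of_bool _).
  by have := congr1 odd ABk; rewrite oddD /= odd_k; do 2 case: (odd _).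
rewrite -mulrDr; congr (_ * _); rewrite mulr_natl mulr2n; congr (_ + _).
by apply: eq_bigr => i _; rewrite mulrAC.
Qed.

Definition comb (T : lie_tree) (w : seq 'I_n) : lie_tree :=
  foldl (fun A l => Node A (Leaf l)) T w.

Lemma leaves_comb T w : leaves (comb T w) = (leaves T + size w)%N.
Proof.
by elim: w T => [|l w IH] T /=; rewrite ?addn0 // IH /= addnAC addn1 addnS.
Qed.

Lemma ab_comb T w : ab (tree_lie T) = 0 -> ab (tree_lie (comb T w)) = 0.
Proof. by elim: w T => [|l w IH] T T0 //=; apply: IH; rewrite /= ab_lie. Qed.

Lemma fox_comb i T w : ab (tree_lie T) = 0 ->
  fox i (tree_lie (comb T w))
    = (-1) ^+ size w * (\prod_(l <- w) 'X_l) * fox i (tree_lie T).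
Proof.
elim: w T => [|l w IH] T T0 /=; first by rewrite big_nil expr0 !mul1r.
rewrite IH /= ?ab_lie // fox_lie T0 ab_flx big_cons exprS; ring.
Qed.

(** The derivation is, up to sign, the one of the tree joining [[x_a, x_p]] to
    [[x_a, x_q, w]]. Both brackets have a nonzero Fox derivative with respect to
    [x_a], which gives the first monomial, and also with respect to [x_p] if
    [p = q], which gives the second. *)
Lemma caterpillar_dvg k (a p q : 'I_n) (w : seq 'I_n) :
    odd k -> size w = (k - 3)%N -> (3 <= k)%N -> p != a -> q != a ->
  exists2 f, f \in b_mod n k &
    dvg f = 2 * (\prod_(l <- w) 'X_l) *
      ('X_a * 'X_p * 'X_q + (p == q)%:R * 'X_a ^+ 2 * 'X_p).
Proof.
move=> odd_k sz_w k3 pa qa.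
pose A := Node (Leaf a) (Leaf p); pose B0 := Node (Leaf a) (Leaf q).
have A0 : ab (tree_lie A) = 0 by rewrite /= ab_lie.
have B00 : ab (tree_lie B0) = 0 by rewrite /= ab_lie.
pose B := comb B0 w; have ABk : (leaves A + leaves B)%N = k.+1.
  by rewrite leaves_comb sz_w /=; lia.
have memAB := edge_der_b_mod ABk.
have sum_fox : \sum_i 'X_i * fox i (tree_lie A) * fox i (tree_lie B0)
    = 'X_a * 'X_p * 'X_q + (p == q)%:R * 'X_a ^+ 2 * 'X_p :> S.
  under eq_bigr do rewrite !fox_lie !ab_flx !fox_flx.
  rewrite (bigD1 a) //= (bigD1 p) //= big1 => [|i /andP[ia ip]]; last first.
    rewrite [a == i]eq_sym [p == i]eq_sym (negPf ia) (negPf ip) !mulr0n.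
    by rewrite !mulr0 subrr mulr0 mul0r.
  rewrite [p == a]eq_sym in pa; rewrite !eqxx (negPf pa) (negPf qa).
  rewrite [p == a]eq_sym (negPf pa) [q == p]eq_sym mulr0n mulr1n; ring.
have dvgAB : dvg (edge_der A B) = (-1) ^+ size w * (2 * (\prod_(l <- w) 'X_l) *
      ('X_a * 'X_p * 'X_q + (p == q)%:R * 'X_a ^+ 2 * 'X_p)).
  rewrite (dvg_edge_der odd_k ABk A0 (ab_comb w B00)) -sum_fox.
  have -> : \sum_i 'X_i * fox i (tree_lie A) * fox i (tree_lie B)
      = (-1) ^+ size w * (\prod_(l <- w) 'X_l) *
        \sum_i 'X_i * fox i (tree_lie A) * fox i (tree_lie B0) :> S.
    by rewrite mulr_sumr; apply: eq_bigr => i _; rewrite (fox_comb i w B00); ring.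
  by rewrite [leaves A]/= sqrrN expr1n; ring.
(* The factor cancels the sign that [fox_comb] contributes for [w]. *)
exists (edge_der A B *~ (-1) ^+ size w); first exact: rpredMz.
rewrite raddfMz /= dvgAB -mulrzr rmorphXn /= rmorphN1 mulrC.
by rewrite mulrA -exprMn mulrNN mulr1 expr1n mul1r.
Qed.

End Trees.

(** * The image of the divergence *)

Section Image.
Variables (n k : nat).
Local Notation S := {mpoly int[n]}.
Implicit Types (P Q : S) (w : seq 'I_n).

(** The monomials [x_i x_p^(k-1)] with [i <= p]. For odd [k >= 3] they span, together
    with the divergences of b_n(k), the polynomials of degree [k] over the
    rationals. *)
Definition spare_mnms : seq 'X_{1..n} :=
  [seq (U_(widen_ord (ltn_ord p) i) + U_(p) *+ k.-1)%MM
     | p <- enum 'I_n, i <- enum 'I_p.+1].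

Lemma mem_spare_mnms (i p : 'I_n) : (i <= p)%N ->
  (U_(i) + U_(p) *+ k.-1)%MM \in spare_mnms.
Proof.
rewrite -ltnS => lt_ip; apply/allpairsPdep; exists p, (Ordinal lt_ip).
rewrite !mem_enum; split=> //; congr (U_(_) + _)%MM; exact: val_inj.
Qed.

Lemma size_spare_mnms : size spare_mnms = ((n * (n + 1)) %/ 2)%N.
Proof.
rewrite size_allpairs_dep sumnE big_map big_enum /=.
under eq_bigr do rewrite size_enum_ord.
have -> : (\sum_(p < n) p.+1 = \sum_(0 <= p < n.+1) p)%N.
  by rewrite big_nat_recl // add0n big_mkord.
by rewrite bin2_sum bin2 /= divn2 addn1 mulnC.
Qed.

(** The congruence of [P] with a divergence modulo the span of [spare_mnms]. *)
Definition dvg_mod_spare P : Prop :=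
  exists2 f, f \in b_mod n k &
    forall m, m \notin spare_mnms -> (dvg f)@_m = P@_m.

Lemma dvg_mod_spareB P Q :
  dvg_mod_spare P -> dvg_mod_spare Q -> dvg_mod_spare (P - Q).
Proof.
move=> [f fk fP] [g gk gQ]; exists (f - g); first exact: rpredB.
by move=> m m_good; rewrite raddfB !mcoeffB fP ?gQ.
Qed.

Lemma dvg_mod_spare_spare m : m \in spare_mnms -> dvg_mod_spare (2 * 'X_[m]).
Proof.
move=> m_spare; exists 0; first exact: rpred0.
move=> l; rewrite raddf0 mcoeff0 mulr_natl mcoeffMn mcoeffX.
by case: eqP => [<-|]; rewrite ?m_spare // mul0rn.
Qed.

Hypotheses (k_ge3 : (3 <= k)%N) (odd_k : odd k).

Lemma dvg_mod_spare_caterpillar (a p q : 'I_n) w :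
    size w = (k - 3)%N -> p != a -> q != a ->
  dvg_mod_spare (2 * (\prod_(l <- w) 'X_l) *
    ('X_a * 'X_p * 'X_q + (p == q)%:R * 'X_a ^+ 2 * 'X_p)).
Proof.
move=> sz_w pa qa; have [f fk dvg_f] := caterpillar_dvg odd_k sz_w k_ge3 pa qa.
by exists f => // m _; rewrite dvg_f.
Qed.

(** Induction on the number of letters of [w] other than [p]: the relation
    [x_i^2 x_p = - x_i x_p^2] trades an [i] for a [p], and a monomial with three
    distinct letters is itself half a divergence. *)
Lemma dvg_mod_spare_two (i p : 'I_n) w : (i < p)%N -> size w = (k - 2)%N ->
  dvg_mod_spare (2 * ('X_i * 'X_p * \prod_(l <- w) 'X_l)).
Proof.
move=> lt_ip; have ip : i != p by rewrite -val_eqE neq_ltn lt_ip.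
have [c] := ubnP (count (predC1 p) w); elim: c w => // c IH w ltc sz_w.
have [/hasP[l lw /= lp]|] := boolP (has (predC1 p) w); last first.
  rewrite has_predC negbK => /all_pred1P ->.
  rewrite big_nseq iter_mulr_1 mpolyXn -!mpolyXD -addmA -mulmS sz_w.
  rewrite (_ : (k - 2).+1 = k.-1); last by move: k_ge3; lia.
  exact/dvg_mod_spare_spare/mem_spare_mnms/ltnW.
have def_w := perm_to_rem lw; set v := rem l w in def_w.
have sz_v : size v = (k - 3)%N.
  by have := perm_size def_w; rewrite sz_w /=; move: k_ge3; lia.
rewrite (perm_big _ def_w) big_cons /=; set V := \prod_(_ <- v) _.
have [li|li] := eqVneq l i; last first.
  have := @dvg_mod_spare_caterpillar l p i v sz_v.
  rewrite [p == l]eq_sym lp [i == l]eq_sym li [p == i]eq_sym (negPf ip).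
  rewrite mulr0n => /(_ isT isT).
  by congr dvg_mod_spare; rewrite -/V; ring.
have := @dvg_mod_spare_caterpillar i p p v sz_v.
rewrite eq_sym ip eqxx mulr1n => /(_ isT isT) cat_ipp.
have sz_pv : size (p :: v) = (k - 2)%N by rewrite /= sz_v; move: k_ge3; lia.
have lt_pv : (count (predC1 p) (p :: v) < c)%N.
  by move/permP: def_w ltc => ->; rewrite /= eqxx lp add0n add1n ltnS.
move: (dvg_mod_spareB cat_ipp (IH _ lt_pv sz_pv)).
by rewrite big_cons -/V li; congr dvg_mod_spare; ring.
Qed.

Lemma mpolyX_m2s (m : 'X_{1..n}) : 'X_[m] = \prod_(l <- m2s m) 'X_l :> S.
Proof.
rewrite mpolyXE_id /m2s big_flatten big_map big_enum /=.
by apply: eq_bigr => i _; rewrite big_nseq iter_mulr_1.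
Qed.

Lemma dvg_mod_spareX (m : 'X_{1..n}) : mdeg m = k -> dvg_mod_spare (2 * 'X_[m]).
Proof.
move=> deg_m; rewrite mpolyX_m2s.
case: (m2s m) (size_m2s m) => [|i w]; rewrite deg_m.
  by move: k_ge3 => /[swap] <-.
move=> sz_w; have [/hasP[l lw /= li]|] := boolP (has (predC1 i) w); last first.
  rewrite has_predC negbK => /all_pred1P ->.
  rewrite big_cons big_nseq iter_mulr_1 mpolyXn -mpolyXD.
  by rewrite -[size w]/(size (i :: w)).-1 sz_w; exact/dvg_mod_spare_spare/mem_spare_mnms.
have def_w := perm_to_rem lw; set v := rem l w in def_w.
have sz_v : size v = (k - 2)%N.
  by have := perm_size def_w; move: sz_w => /=; move: k_ge3; lia.
rewrite big_cons (perm_big _ def_w) big_cons /= [X in 2 * X]mulrA.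
have [lt_il|lt_li|/val_inj eq_il] := ltngtP i l; last by rewrite /= eq_il eqxx in li.
  exact: dvg_mod_spare_two.
by rewrite ['X_i * _]mulrC; exact: dvg_mod_spare_two.
Qed.

End Image.

(** * Lower and upper bounds on the rank of the abelianization *)

Section Bounds.
Variables (n k : nat).
Hypotheses (n_gt0 : (0 < n)%N) (k_ge3 : (3 <= k)%N) (odd_k : odd k).

Lemma mnms_of_degree : exists s : seq 'X_{1..n},
  [/\ uniq s, size s = 'C(n + k - 1, k) & forall m, m \in s -> mdeg m = k].
Proof.
case: n n_gt0 => // n' _.
exists [seq s2m (val t) | t <- enum (basis n'.+1 k)]; split.
- exact: uniq_basis.
- by rewrite size_basis; congr ('C(_, _)); lia.
- by move=> m; rewrite -basis_cover => /eqP.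
Qed.

(** Each monomial [m] of degree [k] outside [spare_mnms] gives a derivation whose
    divergence has, outside [spare_mnms], the coefficient 2 at [m] and 0 elsewhere.
    The coefficients thus separate these derivations. *)
Lemma bH1_deg_zindep : exists r (h : 'I_r -> lieH1 (bLie n)),
  [/\ ('C(n + k - 1, k) <= r + (n * (n + 1)) %/ 2)%N,
      forall i, h i \in bH1_deg n k & zindep h].
Proof.
have [s [s_uniq sz_s s_deg]] := mnms_of_degree.
pose spare : pred _ := fun m => m \in spare_mnms n k.
pose good := filter (predC spare) s.
have [f f_mod f_dvg] : exists2 f : 'I_(size good) -> lieHom n,
    forall i, f i \in b_mod n k &
    forall i (j : 'I_(size good)), (dvg (f i))@_(nth 0%MM good j) = 2 * (i == j)%:R.
  have good_nth (j : 'I_(size good)) :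
      (nth 0%MM good j \notin spare_mnms n k) && (mdeg (nth 0%MM good j) == k).
    have := mem_nth 0%MM (ltn_ord j); rewrite mem_filter => /andP[good_j /s_deg ->].
    by rewrite eqxx andbT; exact: good_j.
  have exf (i : 'I_(size good)) :
      dvg_mod_spare k (2 * 'X_[nth 0%MM good i] : {mpoly int[n]}).
    by apply: dvg_mod_spareX => //; have /andP[_ /eqP] := good_nth i.
  exists (fun i => s2val (cid2 (exf i))) => i; first by case: (cid2 (exf i)).
  move=> j; case: (cid2 _) => /= g _ ->; last by have /andP[] := good_nth j.
  rewrite mulr_natl mcoeffMn mcoeffX nth_uniq ?filter_uniq // mulr_natl.
  by rewrite (inj_eq val_inj).
have f_alg i : f i \in b_alg n.
  by apply: zspan_gen; exists k => //; apply: leq_trans k_ge3.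
pose a i : bLie n := exist _ (f i) (f_alg i).
exists (size good), (fun i => lie_ab (a i)); split.
- rewrite -sz_s -(count_predC spare s) addnC -size_filter leq_add2l.
  rewrite -(size_spare_mnms n k) -size_filter uniq_leq_size ?filter_uniq //.
  by move=> m; rewrite mem_filter => /andP[].
- by move=> i; apply/asboolP; exists (a i); first exact: f_mod.
apply: zindep_lie_ab => c /(congr1 (mcoeff _)) c0 j.
have := c0 (nth 0%MM good j); rewrite raddf_sum mcoeff0 (bigD1 j) //= big1.
  rewrite addr0 raddfMz /= f_dvg eqxx mulr1 -mulrzr /=; lia.
move=> i ij; rewrite raddfMz /= f_dvg (negPf ij) mulr0 mul0rz //.
Qed.

(** Independent classes lift to independent elements of p_n(k), which is spanned by
    finitely many generators. *)
Lemma bH1_deg_rank_bounded : exists N, forall m (h : 'I_m -> lieH1 (bLie n)),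
  (forall i, h i \in bH1_deg n k) -> zindep h -> (m <= N)%N.
Proof.
pose gen (i : 'I_n) (j : k.-tuple 'I_n) :=
  hom1 i (lnormed (rcons [seq flx l | l <- j] (flx i))).
pose gens := [seq gen i j | i <- enum 'I_n, j <- enum {: k.-tuple 'I_n}].
have p_gens f : f \in p_mod n k -> f \in zspan [set` gens].
  move: f; apply: zspan_ind => [_ [i [j ->]]||f g].
  - by apply: zspan_gen; apply/allpairsP; exists (i, j); rewrite !mem_enum.
  - exact: rpred0.
  - exact: rpredB.
exists (size gens) => m h h_deg h_indep.
have exa i : exists a : bLie n, val a \in b_mod n k /\ h i = lie_ab a.
  by have /asboolP[a] := h_deg i; exists a.
have [a /all_and2[a_mod h_ab]] := boolp.choice exa.
apply: (@zindep_le_size _ gens m (fun i => val (a i))) => [i|].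
  by apply: p_gens; case/andP: (a_mod i).
move=> c ac0; apply: (zindep_lift (f := @lie_ab (bLie n)) (v := a)) h_indep _ _.
  by [].
apply: val_inj; rewrite raddf_sum -[RHS]ac0.
by apply: eq_bigr => i _; rewrite (raddfMz val).
Qed.

End Bounds.

Theorem theorem8p1 (n : nat) (hn : (3 <= n)%N) :
  (forall k : nat, (3 <= k)%N -> odd k ->
     'C(n + k - 1, k)%:Z - ((n * (n + 1)) %/ 2)%N%:Z
       <= (zrank (bH1_deg n k))%:Z)
  /\ ~ zfingen (lieH1 (bLie n)).
Proof.
have n_gt0 : (0 < n)%N by apply: leq_trans hn.
split=> [k k_ge3 odd_k|[s s_gen]].
  have [r [h [le_r h_deg h_indep]]] := bH1_deg_zindep n_gt0 k_ge3 odd_k.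
  have [N le_N] := bH1_deg_rank_bounded n k.
  by have := zrank_ge h_deg h_indep le_N; lia.
pose k := (2 * (size s + (n * (n + 1)) %/ 2) + 3)%N.
have k_ge3 : (3 <= k)%N by rewrite leq_addl.
have odd_k : odd k by rewrite oddD mul2n odd_double.
have [r [h [le_r _ h_indep]]] := bH1_deg_zindep n_gt0 k_ge3 odd_k.
have le_rs : (r <= size s)%N by apply: zindep_le_size h_indep => i; exact: s_gen.
(* C(n+k-1, k) >= C(k+1, k) = k+1 *)
have : (k.+1 <= 'C(n + k - 1, k))%N by rewrite -[leqLHS]binSn leq_bin2l //; lia.
by move=> le_k; have := leq_trans le_k le_r; rewrite /k; lia.
Qed.
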